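(* Let $\mathcal H$ be a normalized hypergraph on a finite set $V$ all of whose hyperedges have size two or three. The hypergraph $\mathcal H^\triangle$ is normalized and three-uniform, and $$\operatorname{MinStop}(\mathcal H^\triangle)=\operatorname{MinStop}(\mathcal H)\mathbin{\dot\cup}\mathcal D(\mathcal H)$$ (a disjoint union), where the members of $\operatorname{MinStop}(\mathcal H)$ are viewed as subsets of the enlarged ground set. If $m_i=|E_i|$ for $i\in\{2,3\}$, then $\mathcal H^\triangle$ has $|V|+5m_2$ elements and $4m_2+m_3$ hyperedges, and $L(\mathcal H^\triangle)=|V|+21m_2+4m_3=O(L(\mathcal H))$. The frequency of every element of $V$ is unchanged, while every new element has frequency two. Consequently, $\Delta(\mathcal H^\triangle)\le\max\{\Delta(\mathcal H),2\}$. The construction takes $O(L(\mathcal H))$ time.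
   Context: A hypergraph on a finite set $V$ is a family $\mathcal H\subseteq 2^V$, given by its incidence list; it is normalized if it has no repeated incidences, no duplicate hyperedges and no empty hyperedge, and three-uniform if every hyperedge has exactly three elements. Put $L(\mathcal H)=|V|+|\mathcal H|+\sum_{A\in\mathcal H}|A|$. The frequency of $v\in V$ is $|\{A\in\mathcal H: v\in A\}|$, and $\Delta(\mathcal H)$ is the maximum frequency (empty maximum zero). A stopping set of $\mathcal H$ is a set $S\subseteq V$ with $|A\cap S|\ne1$ for all $A\in\mathcal H$; $\operatorname{MinStop}(\mathcal H)$ is the family of inclusion-minimal nonempty stopping sets. Construction of $\mathcal H^\triangle$. Let $\mathcal H$ be normalized with all hyperedges of size two or three and let $E_i=\{A\in\mathcal H:|A|=i\}$ for $i\in\{2,3\}$. For each $e=\{p_e,q_e\}\in E_2$, introduce a set $J_e=\{a_e,b_e,c_e,d_e,f_e\}$ of five fresh elements (the sets $J_e$ are pairwise disjoint and disjoint from $V$), delete $e$, and add the four hyperedges $\{p_e,q_e,a_e\}$, $\{a_e,d_e,f_e\}$, $\{b_e,c_e,d_e\}$, $\{b_e,c_e,f_e\}$. Retain all hyperedges in $E_3$. The result, on the ground set $V\cup\bigcup_{e\in E_2}J_e$, is $\mathcal H^\triangle$. For $e\in E_2$ let $D_{e,1}=\{b_e,c_e\}$, $D_{e,2}=\{b_e,d_e,f_e\}$, $D_{e,3}=\{c_e,d_e,f_e\}$, and let $\mathcal D(\mathcal H)=\{D_{e,i}: e\in E_2,\ i\in\{1,2,3\}\}$. *)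

(* Defs.v *)
From mathcomp Require Import all_boot.

Set Implicit Arguments.
Unset Strict Implicit.
Unset Printing Implicit Defensive.

(* A hypergraph is given by its incidence list: one list of vertices per
   hyperedge.  As a list of vertices, A has set cardinality #|A|, which differs
   from size A exactly when A has a repeated incidence. *)
Definition hypergraph (V : finType) := seq (seq V).

Section Hypergraph.
Variables (V : finType) (H : hypergraph V).

Definition hyperedges : seq {set V} := [seq [set x in A] | A <- H].

Definition normalized : bool :=
  [&& all uniq H, uniq hyperedges & [::] \notin H].

Definition three_uniform : bool := all (fun A : seq V => #|A| == 3) H.

Definition sizes_two_three : bool :=
  all (fun A : seq V => (#|A| == 2) || (#|A| == 3)) H.

Definition E (i : nat) : hypergraph V := [seq A <- H | #|A| == i].

Definition L : nat := #|V| + size H + \sum_(A <- H) #|A|.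

Definition frequency (v : V) : nat := count (fun A : seq V => v \in A) H.

Definition Delta : nat := \max_(v : V) frequency v.

Definition stopping_set (S : {set V}) : bool :=
  all (fun A : seq V => #|[set x in A] :&: S| != 1) H.

Definition MinStop : {set {set V}} :=
  [set S | minset (fun S' => (S' != set0) && stopping_set S') S].

End Hypergraph.

Section Triangle.
Variables (V : finType) (H : hypergraph V).

Definition edge2 : finType := seq_sub (E H 2).

Definition ground : finType := (V + edge2 * 'I_5)%type.

Definition old (v : V) : ground := inl v.
Definition fresh (e : edge2) (j : 'I_5) : ground := inr (e, j).

Definition a_ (e : edge2) := fresh e (@Ordinal 5 0 isT).
Definition b_ (e : edge2) := fresh e (@Ordinal 5 1 isT).
Definition c_ (e : edge2) := fresh e (@Ordinal 5 2 isT).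
Definition d_ (e : edge2) := fresh e (@Ordinal 5 3 isT).
Definition f_ (e : edge2) := fresh e (@Ordinal 5 4 isT).

(* In the first hyperedge, val e is the list of the two vertices p_e, q_e. *)
Definition gadget (e : edge2) : seq (seq ground) :=
  [:: rcons (map old (val e)) (a_ e);
      [:: a_ e; d_ e; f_ e];
      [:: b_ e; c_ e; d_ e];
      [:: b_ e; c_ e; f_ e]].

Definition triangle : hypergraph ground :=
  map (map old) (E H 3) ++ flatten [seq gadget e | e : edge2].

Definition D1 (e : edge2) : {set ground} := [set b_ e; c_ e].
Definition D2 (e : edge2) : {set ground} := [set b_ e; d_ e; f_ e].
Definition D3 (e : edge2) : {set ground} := [set c_ e; d_ e; f_ e].

Definition Dfamily : {set {set ground}} :=
  [set D1 e | e : edge2] :|: [set D2 e | e : edge2] :|: [set D3 e | e : edge2].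

Definition lift_family (F : {set {set V}}) : {set {set ground}} :=
  [set old @: (S : {set V}) | S in F].

End Triangle.

(* Running time is measured on a unit-cost random access machine with indirect
   addressing, a read-only input tape and a write-only output tape of naturals.
   The only arithmetic is the successor, so a run of t steps on entries at most
   N only handles numbers at most N + t + O(1): the unit-cost measure cannot be
   abused with long numbers. *)
Inductive instr :=
| Read  of nat                  (* R[r] := next input entry, 0 past the end *)
| Write of nat                  (* append R[r] to the output *)
| Const of nat & nat            (* R[r] := k *)
| Copy  of nat & nat            (* R[r] := R[s] *)
| Succ  of nat                  (* R[r] := R[r] + 1 *)
| Fetch of nat & nat            (* R[r] := R[R[s]] *)
| Store of nat & nat            (* R[R[r]] := R[s] *)
| JumpEq of nat & nat & nat.    (* if R[r] = R[s] go to instruction l *)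

Definition program := seq instr.

Record config := Config {
  pc : nat;
  mem : nat -> nat;
  input : seq nat;
  output : seq nat
}.

Definition upd (R : nat -> nat) (r k : nat) : nat -> nat :=
  fun i => if i == r then k else R i.

Definition exec (i : instr) (c : config) : config :=
  let: Config p R u w := c in
  match i with
  | Read r => Config p.+1 (upd R r (head 0 u)) (behead u) w
  | Write r => Config p.+1 R u (rcons w (R r))
  | Const r k => Config p.+1 (upd R r k) u w
  | Copy r s => Config p.+1 (upd R r (R s)) u w
  | Succ r => Config p.+1 (upd R r (R r).+1) u w
  | Fetch r s => Config p.+1 (upd R r (R (R s))) u w
  | Store r s => Config p.+1 (upd R (R r) (R s)) u w
  | JumpEq r s l => Config (if R r == R s then l else p.+1) R u w
  end.

Definition halted (P : program) (c : config) : bool := size P <= pc c.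

Definition step (P : program) (c : config) : config :=
  if onth P (pc c) is Some i then exec i c else c.

Definition start (u : seq nat) : config := Config 0 (fun=> 0) u [::].

Definition computes_in (P : program) (u w : seq nat) (t : nat) : Prop :=
  let c := iter t (step P) (start u) in halted P c /\ output c = w.

(* The input format: numbers of vertices and of hyperedges, then every
   hyperedge as its size followed by the labels of its vertices. *)
Definition encode (V : finType) (lab : V -> 'I_#|V|) (H : hypergraph V) :
    seq nat :=
  #|V| :: size H ::
    flatten [seq size A :: [seq val (lab v) | v <- A] | A : seq V <- H].

Definition normal_incidence_list (V : finType) (K H : hypergraph V) : bool :=
  normalized K && perm_eq (hyperedges K) (hyperedges H).

(* The labels of the old vertices are kept; those of the fresh elements and the
   order in which incidences are listed are left to the program. *)
Definition constructs_triangle (P : program) (V : finType) (H : hypergraph V)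
    (lab : V -> 'I_#|V|) (t : nat) : Prop :=
  exists (lab' : ground H -> 'I_#|ground H|) (K : hypergraph (ground H)),
    [/\ injective lab',
        forall v : V, val (lab' (old H v)) = val (lab v),
        normal_incidence_list K (triangle H)
      & computes_in P (encode lab H) (encode lab' K) t].

(* Main.v *)
Require Import Defs.
From mathcomp Require Import all_boot zify.

(** A stopping set that contains one fresh element of the gadget of e contains
    one of the three sets of that gadget: the gadget hyperedges that avoid V
    propagate membership, since none of them may be met exactly once (lemma
    [stopping_fresh]).  These three sets are themselves stopping and pairwise
    incomparable, so they are exactly the minimal stopping sets of the new
    hypergraph that leave V.  A stopping set inside V misses a_e, hence meets
    {p_e, q_e, a_e} as it meets {p_e, q_e}; and it misses the other three
    hyperedges.  So the stopping sets inside V, and the minimal ones among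
    them, are those of the original hypergraph ([stopping_old],
    [MinStop_triangle]).

    Sizes and frequencies are local counts.  They are obtained by viewing the
    new hypergraph, up to the order of its hyperedges, as the concatenation
    over the hyperedges of H of what replaces each of them
    ([listed_triangle_perm]); the same listing is the one that a program can
    produce while it reads H.

    For the running time, an explicit program for the given machine is run
    symbolically.  The numbers of elements and of hyperedges come first in the
    output but are known only after the whole input has been read, so the
    program stores the new hyperedges in memory, then writes the two numbers,
    then copies the memory to the output.  Each of the two loops takes a
    bounded number of steps for each hyperedge of H ([run_loop], [run_copy]).
    Runs are computed on configurations whose memory is a finite list
    ([represents_iter]): a block of instructions then evaluates even though
    the entries of the memory are variables. *)

Set Implicit Arguments.
Unset Strict Implicit.
Unset Printing Implicit Defensive.

(** * Hypergraphs as lists of lists *)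

Lemma all_flatten (T : Type) (P : pred T) (ss : seq (seq T)) :
  all P (flatten ss) = all (all P) ss.
Proof. by elim: ss => //= s ss IH; rewrite all_cat IH. Qed.

Section Incidences.
Variable V : finType.
Implicit Types (A : seq V) (H : hypergraph V) (S : {set V}).

Lemma card_incidences A S : uniq A -> #|[set x in A] :&: S| = count [in S] A.
Proof.
move=> uA; rewrite -size_filter -(card_uniqP (filter_uniq _ uA)).
by apply: eq_card => x; rewrite !inE mem_filter andbC.
Qed.

Lemma stopping_set_count H S :
  all uniq H -> stopping_set H S = all (fun A => count [in S] A != 1) H.
Proof.
by move=> /allP uH; apply: eq_in_all => A /uH uA; rewrite card_incidences.
Qed.

Lemma normalized_perm (H K : hypergraph V) :
  perm_eq H K -> normalized H = normalized K.
Proof.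
move=> HK; rewrite /normalized (perm_all _ HK) (perm_mem HK).
by rewrite (perm_uniq (perm_map _ HK)).
Qed.

Lemma normalized_uniq H : normalized H -> uniq H.
Proof. by case/and3P=> _ /map_uniq. Qed.

End Incidences.

(** * The gadget construction *)

Section Triangle.
Variables (V : finType) (H : hypergraph V).
Hypotheses (nH : normalized H) (sH : sizes_two_three H).
Implicit Types (e : edge2 H) (T : {set ground H}) (S : {set V}).
Implicit Types (A : seq V) (B : seq (ground H)).

Let uniqH : all uniq H. Proof. by case/and3P: nH. Qed.

Lemma old_inj : injective (@old V H).
Proof. by move=> x y []. Qed.

Lemma fresh_eq e e' j j' : (fresh e j == fresh e' j') = (e == e') && (j == j').
Proof. by []. Qed.

Lemma edge2_mem e : val e \in H.
Proof. by have := ssvalP e; rewrite mem_filter => /andP[]. Qed.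

Lemma edge2_uniq e : uniq (val e).
Proof. exact: (allP uniqH) (edge2_mem e). Qed.

Lemma edge2_size e : size (val e) = 2.
Proof.
rewrite -(card_uniqP (edge2_uniq e)); apply/eqP.
by have := ssvalP e; rewrite mem_filter => /andP[].
Qed.

(** The partial projection [insub] finds the index in [edge2 H] of a hyperedge
    with two elements and fails on the others. *)
Definition replacement A : seq (seq (ground H)) :=
  oapp (@gadget V H) [:: map (old H) A] (insub A).

Variant replacement_spec A : seq (seq (ground H)) -> Type :=
| ReplacePair e of A = val e : replacement_spec A (gadget e)
| KeepTriple of size A = 3 : replacement_spec A [:: map (old H) A].

Lemma replacementP A : A \in H -> replacement_spec A (replacement A).
Proof.
move=> AH; rewrite /replacement; case: insubP => [e _ <-|] /=.
  exact: ReplacePair.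
rewrite mem_filter AH andbT => A2; apply: KeepTriple.
rewrite -(card_uniqP (allP uniqH _ AH)).
by have := allP sH _ AH; rewrite (negPf A2) => /eqP.
Qed.

Definition listed_triangle : hypergraph (ground H) :=
  flatten [seq replacement A | A <- H].

(** Separating the hyperedges of H by size costs only a permutation. *)
Lemma listed_triangle_perm : perm_eq listed_triangle (triangle H).
Proof.
have E3 : E H 3 = [seq A <- H | predC (fun A => #|A| == 2) A].
  apply: eq_in_filter => A /(allP sH) /=.
  by case/orP=> /eqP ->.
apply: (@perm_trans _ (flatten [seq replacement A | A <- E H 3 ++ E H 2])).
  apply/perm_flatten/perm_map; rewrite perm_sym perm_catC E3.
  by apply/permPl/perm_filterC.
rewrite map_cat flatten_cat /triangle.
have -> : flatten [seq replacement A | A <- E H 3] = map (map (old H)) (E H 3).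
  rewrite -[RHS]flatten_seq1 -map_comp; congr flatten; apply/eq_in_map => A.
  rewrite mem_filter /replacement => /andP[/eqP A3 _].
  by rewrite insubN // mem_filter A3.
rewrite perm_cat2l; apply/perm_flatten.
have -> : [seq gadget e | e : edge2 H]
        = [seq replacement A | A <- [seq val e | e : edge2 H]].
  by rewrite -map_comp; apply: eq_map => e; rewrite /replacement /= valK.
apply/perm_map/uniq_perm => [||A].
- exact/filter_uniq/normalized_uniq.
- by rewrite (map_inj_uniq val_inj) enum_uniq.
apply/idP/mapP => [AE|[e _ ->]]; last exact: ssvalP.
by exists (Sub A AE); rewrite ?mem_enum ?SubK.
Qed.

Lemma triangle_all (P : pred (seq (ground H))) :
  all P (triangle H) = all (fun A => all P (replacement A)) H.
Proof.
by rewrite -(perm_all _ listed_triangle_perm) all_flatten all_map.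
Qed.

(** Kept together because each property alone would repeat the case analysis
    on the hyperedges: size three is a cardinality only for lists without
    repetition. *)
Lemma triangle_size3 : all (fun B => uniq B && (size B == 3)) (triangle H).
Proof.
rewrite triangle_all; apply/allP => A AH; case: replacementP => // [e _|A3].
  have uniq_fresh js : uniq js -> uniq (map (fresh e) js).
    by move=> ujs; rewrite map_inj_uniq // => j j' [].
  have mapF j : fresh e j \in map (old H) (val e) = false by apply/mapP => -[].
  apply/and5P; split=> //; rewrite ?andbT; last 3 first.
  - exact: (uniq_fresh [:: _; _; _]).
  - exact: (uniq_fresh [:: _; _; _]).
  - exact: (uniq_fresh [:: _; _; _]).
  rewrite rcons_uniq size_rcons size_map edge2_size mapF.
  by rewrite (map_inj_uniq old_inj) edge2_uniq.
by rewrite all_seq1 (map_inj_uniq old_inj) size_map A3 (allP uniqH _ AH).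
Qed.

Lemma triangle_uniq : all uniq (triangle H).
Proof. by apply: sub_all triangle_size3 => A /andP[]. Qed.

Lemma triangle_three_uniform : three_uniform (triangle H).
Proof.
apply: sub_all triangle_size3 => A /andP[uA A3].
by rewrite (card_uniqP uA).
Qed.

Lemma set_seq_map_old A :
  [set x in map (old H) A] = old H @: [set x in A].
Proof.
apply/setP => x; rewrite inE.
apply/mapP/imsetP => [] [v vA ->]; exists v => //; by rewrite inE in vA *.
Qed.

Lemma fresh_old S e j : (fresh e j \in old H @: S) = false.
Proof. by apply/imsetP => -[]. Qed.

Lemma old_mem S v : (old H v \in old H @: S) = (v \in S).
Proof. exact/mem_imset/old_inj. Qed.

(** With [gadget_fresh_eq], this tells gadgets apart from the old hyperedges and
    from each other. *)
Lemma mem_gadget_fresh e B :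
  B \in gadget e -> exists j, fresh e j \in B.
Proof.
rewrite !inE => /or4P[] /eqP ->;
  [exists (@Ordinal 5 0 isT)|exists (@Ordinal 5 0 isT)
  |exists (@Ordinal 5 1 isT)|exists (@Ordinal 5 1 isT)];
  by rewrite ?mem_rcons !inE eqxx.
Qed.

Lemma gadget_fresh_eq e e' j B : B \in gadget e -> fresh e' j \in B -> e' = e.
Proof.
have mapF : fresh e' j \in map (old H) (val e) = false by apply/mapP => -[].
rewrite !inE => /or4P[] /eqP ->; rewrite ?mem_rcons !inE ?mapF !fresh_eq;
  by rewrite -?andb_orr ?orbF => /andP[/eqP].
Qed.

Lemma gadget_uniq e : uniq (hyperedges (gadget e)).
Proof.
(* Membership of a_e and of d_e distinguishes the four hyperedges. *)
apply: (@map_uniq _ _ (fun T => (a_ e \in T, d_ e \in T))).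
have mapF j : fresh e j \in map (old H) (val e) = false by apply/mapP => -[].
rewrite -map_comp (eq_map (g := fun B => (a_ e \in B, d_ e \in B))); last first.
  by move=> B /=; rewrite !inE.
rewrite (_ : map _ _ = [:: (true, false); (true, true); (false, true);
                           (false, false)]) //.
congr [:: (_, _); (_, _); (_, _); (_, _)];
  by rewrite ?mem_rcons !in_cons ?mapF !fresh_eq eqxx.
Qed.

Lemma gadgets_uniq (es : seq (edge2 H)) :
  uniq es -> uniq (hyperedges (flatten [seq gadget e | e <- es])).
Proof.
elim: es => // e es IH; rewrite cons_uniq => /andP[e_es /IH ues].
rewrite /hyperedges -[flatten _]/(gadget e ++ flatten [seq gadget i | i <- es]).
rewrite map_cat cat_uniq.
rewrite [uniq (map _ _)]gadget_uniq [uniq (map _ _)]ues andbT.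
apply/hasPn => _ /mapP[A /flatten_mapP[e' e'_es Ae'] ->].
apply/mapP => -[B Be /setP AB].
have [j jA] := mem_gadget_fresh Ae'.
have := AB (fresh e' j); rewrite !inE jA => /esym /(gadget_fresh_eq Be) ee'.
by rewrite -ee' e'_es in e_es.
Qed.

Lemma triangle_normalized : normalized (triangle H).
Proof.
rewrite /normalized triangle_uniq /=; apply/andP; split; last first.
  by apply/negP => /(allP triangle_size3).
rewrite /triangle /hyperedges map_cat cat_uniq; apply/and3P; split.
- rewrite -map_comp (eq_map (g := fun A => old H @: [set x in A])); last first.
    by move=> A /=; rewrite set_seq_map_old.
  rewrite (map_comp (fun S : {set V} => old H @: S)) map_inj_uniq; last first.
    exact/imset_inj/old_inj.
  case/and3P: nH => _ uH _.
  by apply: subseq_uniq uH; apply/map_subseq/filter_subseq.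
- apply/hasPn => _ /mapP[A /flatten_mapP[e _ Ae] ->].
  apply/mapP => -[_ /mapP[B _ ->] /setP AB].
  have [j jA] := mem_gadget_fresh Ae.
  by have := AB (fresh e j); rewrite set_seq_map_old fresh_old inE jA.
- exact/gadgets_uniq/enum_uniq.
Qed.

Lemma size_triangle : size (triangle H) = 4 * size (E H 2) + size (E H 3).
Proof.
rewrite size_cat size_map addnC; congr (_ + _).
rewrite -(@card_seq_sub _ (E H 2)); last exact/filter_uniq/normalized_uniq.
rewrite size_flatten /shape -map_comp sumnE big_map big_enum /=.
by rewrite sum_nat_const mulnC.
Qed.

Lemma card_ground : #|ground H| = #|V| + 5 * size (E H 2).
Proof.
rewrite card_sum card_prod card_ord card_seq_sub 1?mulnC //.
exact/filter_uniq/normalized_uniq.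
Qed.

Lemma L_uniform (W : finType) (K : hypergraph W) :
  three_uniform K -> L K = #|W| + 4 * size K.
Proof.
rewrite /L => /allP K3; rewrite big_seq (eq_bigr (fun=> 3)) => [|A /K3/eqP//].
by rewrite -big_seq big_const_seq iter_addn_0 count_predT -addnA -mulSn.
Qed.

Lemma L_triangle :
  L (triangle H) = #|V| + 21 * size (E H 2) + 4 * size (E H 3).
Proof.
rewrite (L_uniform triangle_three_uniform) card_ground size_triangle.
rewrite mulnDr mulnA.
by rewrite -!addnA; congr (_ + _); rewrite !addnA -mulnDl.
Qed.

Lemma size_E23 : size H = size (E H 2) + size (E H 3).
Proof.
rewrite !size_filter -(count_predC (fun A : seq V => #|A| == 2) H).
congr (_ + _); apply: eq_in_count => A /(allP sH) /=.
by case/orP=> /eqP ->.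
Qed.

Lemma L_triangle_le : L (triangle H) <= 21 * L H.
Proof.
rewrite L_triangle /L size_E23 !mulnDr; apply: leq_trans (leq_addr _ _).
rewrite addnA; apply: leq_add; last by rewrite leq_mul2r orbT.
by rewrite leq_add2r leq_pmull.
Qed.

Lemma frequency_old v : frequency (triangle H) (old H v) = frequency H v.
Proof.
rewrite /frequency -(permP listed_triangle_perm) count_flatten -map_comp.
rewrite -sumn_count; congr sumn; apply/eq_in_map => A AH /=.
case: replacementP => // [e ->|_] /=; rewrite ?mem_rcons ?inE;
  by rewrite (mem_map old_inj) !addn0.
Qed.

Lemma gadget_frequency e e' j :
  count (fun B => fresh e j \in B) (gadget e') = if e' == e then 2 else 0.
Proof.
have mapF : fresh e j \in map (old H) (val e') = false by apply/mapP => -[].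
have mem_fresh js : (fresh e j \in map (fresh e') js) = (e == e') && (j \in js).
  elim: js => [|i js IH]; first by rewrite andbF.
  by rewrite map_cons !in_cons fresh_eq IH andb_orr.
pose o k k5 := @Ordinal 5 k k5.
(* One list of fresh indices for each of the four hyperedges; every index
   below 5 occurs in exactly two of the lists. *)
transitivity (\sum_(js <- [:: [:: o 0 isT]; [:: o 0 isT; o 3 isT; o 4 isT];
    [:: o 1 isT; o 2 isT; o 3 isT]; [:: o 1 isT; o 2 isT; o 4 isT]])
    ((e == e') && (j \in js)) : nat).
  rewrite !big_cons big_nil;
  congr (nat_of_bool _ + (nat_of_bool _ +
    (nat_of_bool _ + (nat_of_bool _ + _)))).
  - by rewrite mem_rcons in_cons mapF orbF -mem_fresh mem_seq1.
  - by rewrite -mem_fresh.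
  - by rewrite -mem_fresh.
  - by rewrite -mem_fresh.
rewrite eq_sym !big_cons big_nil; case: eqP => //= _.
by case: j {mapF mem_fresh} => [[|[|[|[|[|]]]]] jlt].
Qed.

Lemma frequency_fresh e j : frequency (triangle H) (fresh e j) = 2.
Proof.
rewrite /frequency count_cat count_flatten -map_comp sumnE big_map big_enum.
rewrite (_ : count _ _ = 0) ?add0n.
  rewrite (eq_bigr (fun e' => if e' == e then 2 else 0)) => [|e' _].
    by rewrite -big_mkcond big_pred1_eq.
  exact: gadget_frequency.
apply/eqP; rewrite -leqn0 leqNgt -has_count; apply/hasPn => _ /mapP[A _ ->].
by apply/mapP => -[].
Qed.

Lemma Delta_triangle : Delta (triangle H) <= maxn (Delta H) 2.
Proof.
apply/bigmax_leqP => -[v|[e j]] _.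
  by rewrite frequency_old leq_max (leq_bigmax (F := frequency H)).
by rewrite frequency_fresh leq_maxr.
Qed.

(** * Minimal stopping sets *)

Lemma stopping_gadget T e :
  all (fun B => count [in T] B != 1) (gadget e) =
  [&& count [in T] (map (old H) (val e)) + (a_ e \in T) != 1,
      (a_ e \in T) + (d_ e \in T) + (f_ e \in T) != 1,
      (b_ e \in T) + (c_ e \in T) + (d_ e \in T) != 1
    & (b_ e \in T) + (c_ e \in T) + (f_ e \in T) != 1].
Proof.
rewrite /gadget /all -[rcons _ _]cats1 count_cat andbT.
by rewrite /count !addn0 !addnA.
Qed.

Lemma stopping_triangle T :
  stopping_set (triangle H) T =
  all (fun A => all (fun B => count [in T] B != 1) (replacement A)) H.
Proof. by rewrite stopping_set_count ?triangle_uniq // triangle_all. Qed.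

(** A set inside V misses a_e, so it meets {p_e, q_e, a_e} in as many elements
    as {p_e, q_e}, and it misses the other gadget hyperedges. *)
Lemma stopping_old S :
  stopping_set (triangle H) (old H @: S) = stopping_set H S.
Proof.
rewrite stopping_triangle stopping_set_count //.
have countE A : count [in old H @: S] (map (old H) A) = count [in S] A.
  by rewrite count_map; apply: eq_count => v /=; rewrite old_mem.
apply: eq_in_all => A AH; case: replacementP => // [e ->|_].
  by rewrite stopping_gadget countE !fresh_old !andbT addn0.
by rewrite all_seq1 countE.
Qed.

Lemma stopping_gadgetP T e :
  stopping_set (triangle H) T -> all (fun B => count [in T] B != 1) (gadget e).
Proof.
rewrite stopping_triangle => /allP/(_ _ (edge2_mem e)).
by rewrite /replacement valK.
Qed.

Lemma Dfamily_ind (P : {set ground H} -> Prop) :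
  (forall e, P (D1 e)) -> (forall e, P (D2 e)) -> (forall e, P (D3 e)) ->
  forall D, D \in Dfamily H -> P D.
Proof.
by move=> P1 P2 P3 D; rewrite !inE => /orP[/orP[]|] /imsetP[e _ ->].
Qed.

Lemma D1_in e : D1 e \in Dfamily H.
Proof. by rewrite !in_setU imset_f. Qed.
Lemma D2_in e : D2 e \in Dfamily H.
Proof. by rewrite !in_setU (imset_f (@D2 V H)) ?orbT. Qed.
Lemma D3_in e : D3 e \in Dfamily H.
Proof. by rewrite !in_setU (imset_f (@D3 V H)) ?orbT. Qed.

(** If a_e is in T then so is d_e or f_e; if d_e or f_e is, then so is b_e or
    c_e; and if only one of b_e and c_e is, then both d_e and f_e are. *)
Lemma stopping_fresh T e j : stopping_set (triangle H) T -> fresh e j \in T ->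
  exists2 D, D \in Dfamily H & D \subset T.
Proof.
move=> /(stopping_gadgetP e); rewrite stopping_gadget => stopT eT.
have : [|| a_ e \in T, b_ e \in T, c_ e \in T, d_ e \in T | f_ e \in T].
  move: eT; case: j => [[|[|[|[|[|]]]]] jlt] //;
  by rewrite (bool_irrelevance jlt isT) => ->; rewrite ?orbT.
have sub2 x y : x \in T -> y \in T -> [set x; y] \subset T.
  by move=> xT yT; rewrite subUset !sub1set xT.
have sub3 x y z : x \in T -> y \in T -> z \in T -> [set x; y; z] \subset T.
  by move=> xT yT zT; rewrite !subUset !sub1set xT yT.
move: stopT; case a: (a_ e \in T); case b: (b_ e \in T); case c: (c_ e \in T);
  case d: (d_ e \in T); case f: (f_ e \in T); rewrite ?andbF //= => _ _;
  by [exists (D1 e); [exact: D1_in|exact: sub2]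
     |exists (D2 e); [exact: D2_in|exact: sub3]
     |exists (D3 e); [exact: D3_in|exact: sub3]].
Qed.

Lemma mem_D1 e e' j : (fresh e' j \in D1 e) =
  (e' == e) && (nat_of_ord j \in [:: 1; 2]).
Proof. by rewrite !in_setU !in_set1 !fresh_eq -!andb_orr !in_cons orbF. Qed.

Lemma mem_D2 e e' j : (fresh e' j \in D2 e) =
  (e' == e) && (nat_of_ord j \in [:: 1; 3; 4]).
Proof.
by rewrite !in_setU !in_set1 !fresh_eq -!andb_orr !in_cons orbF orbA.
Qed.

Lemma mem_D3 e e' j : (fresh e' j \in D3 e) =
  (e' == e) && (nat_of_ord j \in [:: 2; 3; 4]).
Proof.
by rewrite !in_setU !in_set1 !fresh_eq -!andb_orr !in_cons orbF orbA.
Qed.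

Lemma old_Dfamily D v : D \in Dfamily H -> old H v \notin D.
Proof.
by move: D; apply: Dfamily_ind => e; rewrite !in_setU !in_set1.
Qed.

Lemma Dfamily_fresh D : D \in Dfamily H -> exists e j, fresh e j \in D.
Proof.
move: D; apply: Dfamily_ind => e; exists e.
- by exists (@Ordinal 5 1 isT); rewrite mem_D1 eqxx.
- by exists (@Ordinal 5 3 isT); rewrite mem_D2 eqxx.
- by exists (@Ordinal 5 3 isT); rewrite mem_D3 eqxx.
Qed.

Lemma stopping_Dfamily D : D \in Dfamily H -> stopping_set (triangle H) D.
Proof.
move=> DH; rewrite stopping_triangle; apply/allP => A AH.
have count0 A' : count [in D] (map (old H) A') = 0.
  by rewrite count_map -(count_pred0 A'); apply: eq_count => v /=;
    apply/negbTE/old_Dfamily.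
case: replacementP => // [e _|_]; last by rewrite all_seq1 count0.
rewrite stopping_gadget count0; move: D DH {count0}.
apply: Dfamily_ind => e'; rewrite ?mem_D1 ?mem_D2 ?mem_D3;
  by case: (e == e').
Qed.

Lemma Dfamily_antichain D D' :
  D \in Dfamily H -> D' \in Dfamily H -> D' \subset D -> D' = D.
Proof.
move=> DH D'H /subsetP sub.
have {}sub x : (x \in D') ==> (x \in D) by apply/implyP/sub.
move: D DH D' D'H sub.
apply: Dfamily_ind => e D' D'H; move: D' D'H; apply: Dfamily_ind => e' sub;
  move: (sub (b_ e')) (sub (c_ e')) (sub (d_ e'));
  rewrite ?mem_D1 ?mem_D2 ?mem_D3 eqxx; by case: eqP => // ->.
Qed.

Lemma only_old T : (forall e j, fresh e j \notin T) ->
  T = old H @: (old H @^-1: T).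
Proof.
move=> Told; apply/setP => -[v|[e j]].
  by rewrite [inl v]/(old H v) old_mem inE.
by rewrite [inr _]/(fresh e j) fresh_old (negPf (Told e j)).
Qed.

(** A nonempty stopping subset of D has a fresh element, hence contains some D'
    of the family, and D' = D because the family is an antichain. *)
Lemma MinStop_Dfamily D : D \in Dfamily H -> D \in MinStop (triangle H).
Proof.
move=> DH; rewrite inE; apply/minsetP; split=> [|T /andP[T0 stopT] TD].
  rewrite stopping_Dfamily // andbT; apply/set0Pn.
  by have [e [j eD]] := Dfamily_fresh DH; exists (fresh e j).
have [[v|[e j]] xT] := set0Pn _ T0.
  by have := old_Dfamily v DH; rewrite (subsetP TD).
have [D' D'H D'T] := stopping_fresh stopT xT.
have D'D := Dfamily_antichain DH D'H (subset_trans D'T TD).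
by apply/eqP; rewrite eqEsubset TD -D'D.
Qed.

(** Subsets of V lift to subsets of V, so minimality is tested on both sides
    against the same sets. *)
Lemma MinStop_old S : (old H @: S \in MinStop (triangle H)) = (S \in MinStop H).
Proof.
have nz S' : (old H @: S' != set0) = (S' != set0).
  by rewrite -!card_gt0 card_imset //; apply: old_inj.
rewrite !inE; apply/minsetP/minsetP; rewrite stopping_old nz => -[stopS minS].
  split=> // S' stopS' S'S; apply: (imset_inj old_inj); apply: minS.
    by rewrite nz stopping_old.
  exact: imsetS.
split=> // T stopT TS.
have [S' TS'] : exists S', T = old H @: S'.
  exists (old H @^-1: T); apply: only_old => e j; apply/negP => /(subsetP TS).
  by rewrite fresh_old.
move: stopT TS; rewrite {}TS' nz stopping_old => stopS' sub.
rewrite (minS S') //; apply/subsetP => v vS'.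
by rewrite -old_mem (subsetP sub) ?old_mem.
Qed.

Lemma MinStop_triangle :
  MinStop (triangle H) = lift_family H (MinStop H) :|: Dfamily H.
Proof.
apply/setP => T; rewrite in_setU; apply/idP/orP; last first.
  by case=> [/imsetP[S minS ->]|/MinStop_Dfamily//]; rewrite MinStop_old.
move=> minT; have := minT; rewrite inE => /minsetP[/andP[_ stopT] {}Tmin].
have [/existsP[[e j] eT]|/existsPn Tnew] :=
  boolP [exists x : edge2 H * 'I_5, fresh x.1 x.2 \in T].
  right; have [D DH DT] := stopping_fresh stopT eT.
  rewrite -(Tmin D) // stopping_Dfamily // andbT.
  by have [e' [j' eD]] := Dfamily_fresh DH; apply/set0Pn; exists (fresh e' j').
have Told e j : fresh e j \notin T := Tnew (e, j).
left; rewrite (only_old Told).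
by apply: imset_f; rewrite -MinStop_old -only_old.
Qed.

Lemma disjoint_lift (F : {set {set V}}) :
  [disjoint lift_family H F & Dfamily H].
Proof.
rewrite disjoint_subset; apply/subsetP => _ /imsetP[S _ ->].
rewrite inE; apply/negP => /Dfamily_fresh[e [j]].
by rewrite fresh_old.
Qed.

End Triangle.

(** * Symbolic runs *)

(** Configurations whose memory is a list, zero beyond its end.  Every reachable
    memory has this form, and unlike updates of functions, updates of lists
    reduce to a normal form, so that no extensionality is needed to compare
    memories. *)
Record lconfig := LConfig {
  lpc : nat;
  lmem : seq nat;
  linput : seq nat;
  loutput : seq nat
}.

Definition lexec (i : instr) (l : lconfig) : lconfig :=
  let: LConfig p R u w := l in
  let wr r k := set_nth 0 R r k in
  let rd r := nth 0 R r in
  match i with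
  | Read r => LConfig p.+1 (wr r (head 0 u)) (behead u) w
  | Write r => LConfig p.+1 R u (rcons w (rd r))
  | Const r k => LConfig p.+1 (wr r k) u w
  | Copy r s => LConfig p.+1 (wr r (rd s)) u w
  | Succ r => LConfig p.+1 (wr r (rd r).+1) u w
  | Fetch r s => LConfig p.+1 (wr r (rd (rd s))) u w
  | Store r s => LConfig p.+1 (wr (rd r) (rd s)) u w
  | JumpEq r s j => LConfig (if rd r == rd s then j else p.+1) R u w
  end.

Definition lstep (P : program) (l : lconfig) : lconfig :=
  if onth P (lpc l) is Some i then lexec i l else l.

Definition represents (l : lconfig) (c : config) : Prop :=
  [/\ pc c = lpc l, Defs.mem c =1 nth 0 (lmem l), input c = linput l
    & output c = loutput l].

Lemma represents_step P l c :
  represents l c -> represents (lstep P l) (step P c).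
Proof.
case: l c => [p R u w] [q M u' w'] [/= -> MR -> ->].
rewrite /lstep /step /=; case: (onth P p) => [[]|] //= *; split=> //=;
  first [by rewrite !MR | by move=> i; rewrite nth_set_nth /= /upd !MR].
Qed.

Lemma represents_iter P t l c :
  represents l c -> represents (iter t (lstep P) l) (iter t (step P) c).
Proof. by move=> lc; elim: t => //= t; apply: represents_step. Qed.

Definition reaches (P : program) (t : nat) (l l' : lconfig) : Prop :=
  iter t (lstep P) l = l'.

Lemma reaches_trans P t t' l l' l'' :
  reaches P t l l' -> reaches P t' l' l'' -> reaches P (t + t') l l''.
Proof. by rewrite /reaches addnC iterD => -> ->. Qed.

(** The initial zero memory is represented by a list of z zeros for any z, so
    that z can be chosen to cover the registers of the program. *)
Lemma reaches_computes P z t u w l :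
  reaches P t (LConfig 0 (nseq z 0) u [::]) l ->
  size P <= lpc l -> loutput l = w -> computes_in P u w t.
Proof.
move=> run halt_l out_l; rewrite /computes_in /halted.
have := @represents_iter P t (LConfig 0 (nseq z 0) u [::]) (start u).
rewrite [iter t (lstep P) _]run => -[|-> _ _ ->] //; split=> //= i.
by rewrite nth_nseq if_same.
Qed.

(** What stores at consecutive addresses evaluate to. *)
Fixpoint store_at (s : seq nat) (k : nat) (xs : seq nat) : seq nat :=
  if xs is x :: xs' then store_at (set_nth 0 s k x) k.+1 xs' else s.

Lemma store_at_end s xs : store_at s (size s) xs = s ++ xs.
Proof.
elim: xs s => [|x xs IH] s /=; first by rewrite cats0.
have -> : set_nth 0 s (size s) x = rcons s x by elim: s {IH} => //= y s ->.
by rewrite -(size_rcons s x) IH cat_rcons.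
Qed.

(** * The program *)

(** Registers: 0, number m of hyperedges to read; 1, number i of hyperedges
    read; 2, number M of hyperedges stored; 3, number N of labels used, which
    is also the next free label; 4, first free address; 5 and 6, scratch;
    7 and 8, constants 2 and 3; 9 to 13, labels of a, b, c, d, f.  Storage
    starts at address 14.  Unconditional jumps compare register 7 to itself.
    The addresses below are the positions of the blocks in the program. *)
Definition loop_at := 5.
Definition pair_at := 22.
Definition dump_at := 63.
Definition copy_at := 66.
Definition end_at := 71.
Definition base := 14.

Definition emit (r : nat) : program := [:: Store 4 r; Succ 4].

Definition prologue : program :=
  [:: Read 3; Read 0; Const 4 base; Const 7 2; Const 8 3].

(** Every hyperedge stored starts with its size 3 and the two elements that
    are present in any case. *)
Definition read_two : program :=
  [:: Succ 1; Read 6] ++ emit 8 ++ Read 5 :: emit 5 ++ Read 5 :: emit 5.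

Definition finish_triple : program :=
  Read 5 :: emit 5 ++ [:: Succ 2; JumpEq 7 7 loop_at].

Definition finish_pair : program :=
  flatten [seq [:: Copy r 3; Succ 3] | r <- [:: 9; 10; 11; 12; 13]] ++
  flatten [seq emit r |
    r <- [:: 9; 8; 9; 12; 13; 8; 10; 11; 12; 8; 10; 11; 13]] ++
  nseq 4 (Succ 2) ++ [:: JumpEq 7 7 loop_at].

Definition dump : program :=
  [:: Write 3; Write 2; Const 5 base;
      JumpEq 5 4 end_at; Fetch 6 5; Write 6; Succ 5; JumpEq 7 7 copy_at].

Definition triangle_program : program :=
  prologue ++
  JumpEq 1 0 dump_at :: read_two ++ JumpEq 6 7 pair_at :: finish_triple ++
  finish_pair ++ dump.

Local Notation run := (reaches triangle_program).

(** The sequence J gives the contents of the scratch registers and of the label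
    registers.  Its entry 0 is register 5, the address reached by the copying
    loop. *)
Definition memory (m i M N : nat) (J : nat -> nat) (buf : seq nat) :=
  [:: m, i, M, N, base + size buf, J 0, J 1, 2, 3, J 2, J 3, J 4, J 5, J 6
   & buf].

Definition code (es : seq (seq nat)) := flatten [seq size A :: A | A <- es].

Definition is_pair (A : seq nat) := size A == 2.
Definition pair_or_triple (A : seq nat) := is_pair A || (size A == 3).

Definition label_gadget (N : nat) (A : seq nat) : seq (seq nat) :=
  [:: rcons A N; [:: N; 3 + N; 4 + N]; [:: 1 + N; 2 + N; 3 + N];
      [:: 1 + N; 2 + N; 4 + N]].

Fixpoint label_triangle (N : nat) (es : seq (seq nat)) : seq (seq nat) :=
  if es is A :: es' then
    if is_pair A then label_gadget N A ++ label_triangle (5 + N) es'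
    else A :: label_triangle N es'
  else [::].

Lemma code_cat es es' : code (es ++ es') = code es ++ code es'.
Proof. by rewrite /code map_cat flatten_cat. Qed.

(** The two sides of a run agree syntactically after evaluation only if the
    appended block is expressed as consecutive stores. *)
Lemma memory_cat m i M N J buf xs :
  memory m i M N J (buf ++ xs) =
  [:: m, i, M, N, size xs + (base + size buf), J 0, J 1, 2, 3, J 2, J 3, J 4,
      J 5, J 6 & store_at buf (size buf) xs].
Proof. by rewrite /memory store_at_end size_cat addnA addnC. Qed.

(** The only test of an iteration that does not evaluate: m and i are
    variables. *)
Lemma run_enter m i M N J buf u : i != m ->
  run 1 (LConfig loop_at (memory m i M N J buf) u [::])
        (LConfig loop_at.+1 (memory m i M N J buf) u [::]).
Proof. by move=> im; rewrite /reaches /= /lstep /= (negPf im). Qed.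

Lemma run_triple m i M N J buf x y z u : i != m ->
  exists J', run 17
    (LConfig loop_at (memory m i M N J buf) [:: 3, x, y, z & u] [::])
    (LConfig loop_at (memory m i.+1 M.+1 N J' (buf ++ [:: 3; x; y; z])) u [::]).
Proof.
move=> im; exists (nth 0 [:: z; 3; J 2; J 3; J 4; J 5; J 6]).
apply: (reaches_trans (t := 1) (t' := 16) (run_enter _ _ _ _ _ im)).
by rewrite memory_cat; vm_compute.
Qed.

Lemma run_pair m i M N J buf p q u : i != m ->
  exists J', run 53
    (LConfig loop_at (memory m i M N J buf) [:: 2, p, q & u] [::])
    (LConfig loop_at (memory m i.+1 (4 + M) (5 + N) J'
       (buf ++ code (label_gadget N [:: p; q]))) u [::]).
Proof.
move=> im; exists (nth 0 [:: q; 2; N; 1 + N; 2 + N; 3 + N; 4 + N]).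
apply: (reaches_trans (t := 1) (t' := 52) (run_enter _ _ _ _ _ im)).
by rewrite memory_cat; vm_compute.
Qed.

(** Address base + j is read when j entries have been written. *)
Lemma run_copy m i M N buf k : forall j J w,
  J 0 = base + j -> size buf = j + k ->
  exists l,
    [/\ run (5 * k + 1) (LConfig copy_at (memory m i M N J buf) [::] w) l,
    lpc l = end_at & loutput l = w ++ drop j buf].
Proof.
elim: k => [|k IH] j J w J0 size_buf.
  rewrite addn0 in size_buf; rewrite drop_oversize ?size_buf // cats0.
  exists (LConfig end_at (memory m i M N J buf) [::] w); split=> //.
  by rewrite /reaches /= /lstep /= J0 size_buf eqxx.
pose J' := nth 0 [:: base + j.+1; nth 0 buf j; J 2; J 3; J 4; J 5; J 6].
have [//||l [run_l end_l out_l]] := IH j.+1 J' (rcons w (nth 0 buf j)).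
  by rewrite size_buf addSnnS.
exists l; split=> //; last first.
  by rewrite out_l cat_rcons -drop_nth // size_buf -addSnnS leq_addr.
rewrite mulnS -addnA; apply: reaches_trans run_l.
apply: (@reaches_trans _ 1 4 _
  (LConfig copy_at.+1 (memory m i M N J buf) [::] w)).
  rewrite /reaches /= /lstep /= J0 (_ : _ == _ = false) //.
  by rewrite size_buf eqn_add2l -[X in X == _]addn0 eqn_add2l.
by rewrite /memory J0; vm_compute.
Qed.

Lemma size_code_label_triangle N es : all pair_or_triple es ->
  size (code (label_triangle N es)) <= 16 * size es.
Proof.
elim: es N => // A es IH N /andP[A23 /IH {}IH].
rewrite /label_triangle -/label_triangle mulnS.
move: A23; rewrite /pair_or_triple; case: ifP => [A2 _|_ A3].
  by rewrite code_cat size_cat leq_add //= !size_cat size_rcons (eqP A2).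
rewrite -cat1s code_cat size_cat leq_add //.
by rewrite /= cats0 (eqP (A3 : size A == 3)).
Qed.

Lemma run_loop es : all pair_or_triple es -> forall i M N J buf,
  let K := label_triangle N es in
  let m := size es + i in
  exists t J', t <= 53 * size es + 1 /\
    run t (LConfig loop_at (memory m i M N J buf) (code es) [::])
      (LConfig dump_at (memory m m (size K + M) (5 * count is_pair es + N) J'
         (buf ++ code K)) [::] [::]).
Proof.
elim: es => [_|A es IH /andP[A23 /IH {}IH]] i M N J buf.
  exists 1, J; split=> //; rewrite cats0 !add0n.
  by rewrite /reaches /= /lstep /= eqxx.
have im : i != size es + i.+1 by lia.
rewrite -[code (A :: es)]/(size A :: A ++ code es) /= addSnnS.
move: A23; rewrite /pair_or_triple; case: ifP => [|_] /=.
  case: A => [|p [|q []]] //= _ _.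
  have [J1 run1] := run_pair M N J buf p q (code es) im.
  have [t [J2 [t_le run2]]] := IH i.+1 (4 + M) (5 + N) J1
    (buf ++ code (label_gadget N [:: p; q])).
  exists (53 + t), J2; split; first lia.
  apply: reaches_trans run1 _; move: run2; rewrite -catA -code_cat.
  set K' := label_triangle _ es.
  rewrite (_ : size K' + (4 + M) = (size K').+4 + M); last by lia.
  by rewrite (_ : _ + (5 + N) = 5 * (1 + count is_pair es) + N); last by lia.
case: A => [|x [|y [|z []]]] //= _.
have [J1 run1] := run_triple M N J buf x y z (code es) im.
have [t [J2 [t_le run2]]] := IH i.+1 M.+1 N J1 (buf ++ [:: 3; x; y; z]).
exists (17 + t), J2; split; first lia.
by apply: reaches_trans run1 _; move: run2; rewrite -catA -[_ + M.+1]addSnnS.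
Qed.

(** The constant: 5 steps of initialization, at most 53 for each hyperedge read
    plus one to leave the loop, 3 before copying, and 5 for each of the at most
    16 entries stored per hyperedge plus one to leave that loop; altogether at
    most 133 m + 10. *)
Lemma triangle_program_correct n es : all pair_or_triple es ->
  exists2 t, t <= 133 * (size es).+1 &
    computes_in triangle_program (n :: size es :: code es)
      (5 * count is_pair es + n :: size (label_triangle n es) ::
         code (label_triangle n es)) t.
Proof.
move=> es23; set N := 5 * _ + n; set K := label_triangle n es.
have [t1 [J1 [t1_le]]] := run_loop es23 0 0 n (fun=> 0) [::].
rewrite !addn0 cat0s -/N -/K => run1.
pose J2 := fun r => if r is 0 then base + 0 else J1 r.
have [//|//|l [run2 end_l out_l]] := @run_copy (size es) (size es)
  (size K) N (code K) (size (code K)) 0 J2 [:: N; size K].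
exists (5 + (t1 + (3 + (5 * size (code K) + 1)))).
  by have := size_code_label_triangle n es23; rewrite -/K; lia.
apply: (@reaches_computes _ 14 _ _ _ l); rewrite ?end_l ?out_l ?drop0 //.
apply: (@reaches_trans _ 5 _ _ (LConfig loop_at
  (memory (size es) 0 0 n (fun=> 0) [::]) (code es) [::])) => //.
by apply: reaches_trans run1 _; apply: (@reaches_trans _ 3 _ _ _ _ _ run2).
Qed.

(** * Labels of the enlarged ground set *)

Section Labels.
Variables (V : finType) (H : hypergraph V) (lab : V -> 'I_#|V|).
Hypotheses (nH : normalized H) (sH : sizes_two_three H).
Hypothesis lab_inj : injective lab.
Implicit Types (e : edge2 H).

(** The labels that the program gives: the pairs receive, in the order of the
    input, consecutive blocks of five labels above those of V. *)
Definition ground_label (x : ground H) : nat :=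
  match x with
  | inl v => lab v
  | inr (e, j) => j + (5 * index (val e) (E H 2) + #|V|)
  end.

Lemma edge2_index_lt e : index (val e) (E H 2) < size (E H 2).
Proof. by rewrite index_mem; apply: ssvalP. Qed.

Lemma ground_label_lt x : ground_label x < #|ground H|.
Proof.
rewrite card_ground //; case: x => [v|[e j]] /=.
  by apply: leq_trans (ltn_ord _) _; apply: leq_addr.
have := edge2_index_lt e; have := ltn_ord j.
by move: (nat_of_ord j) (index _ _) (size _) => k i m k5 im; lia.
Qed.

Lemma base5_inj i i' k k' : k < 5 -> k' < 5 ->
  k + 5 * i = k' + 5 * i' -> k = k' /\ i = i'.
Proof. by lia. Qed.

Lemma ground_label_inj : injective ground_label.
Proof.
move=> [v|[e j]] [v'|[e' j']] /= eq_lab.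
- by congr inl; apply/lab_inj/val_inj.
- by have := ltn_ord (lab v); rewrite eq_lab addnA ltnNge leq_addl.
- by have := ltn_ord (lab v'); rewrite -eq_lab addnA ltnNge leq_addl.
have {}eq_lab :
    j + 5 * index (val e) (E H 2) = j' + 5 * index (val e') (E H 2).
  by apply: (@addIn #|V|); rewrite -[LHS]addnA -[RHS]addnA.
have [/val_inj jj' ii'] := base5_inj (ltn_ord j) (ltn_ord j') eq_lab.
have /val_inj -> := index_inj (val e) (ssvalP e) (ssvalP e') ii'.
by rewrite jj'.
Qed.

Definition ground_lab (x : ground H) : 'I_#|ground H| :=
  Ordinal (ground_label_lt x).

Lemma index_E (H1 H2 : hypergraph V) A i :
  uniq (H1 ++ A :: H2) -> #|A| == i ->
  index A (E (H1 ++ A :: H2) i) = size (E H1 i).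
Proof.
rewrite cat_uniq /= => /and3P[_ + _] Ai; rewrite negb_or => /andP[A_H1 _].
rewrite /E filter_cat index_cat mem_filter (negPf A_H1) andbF.
by rewrite /= Ai /= eqxx addn0.
Qed.

(** H1 is what has been read: its pairs have used the labels below the one from
    which [label_triangle] starts. *)
Lemma listed_triangle_labels H1 H2 : H = H1 ++ H2 ->
  [seq [seq ground_label x | x <- B]
     | B <- flatten [seq replacement H A | A <- H2]] =
  label_triangle (5 * size (E H1 2) + #|V|)
    [seq [seq val (lab v) | v <- A] | A <- H2].
Proof.
elim: H2 H1 => //= A H2 IH H1 HE.
have AH : A \in H by rewrite HE mem_cat mem_head orbT.
have {}IH := IH (rcons H1 A); rewrite cat_rcons in IH; have {}IH := IH HE.
rewrite map_cat {}IH.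
have sizeE : size (E (rcons H1 A) 2) = (#|A| == 2) + size (E H1 2).
  by rewrite /E filter_rcons; case: ifP => _ //; rewrite size_rcons.
have old_labels :
    [seq ground_label x | x <- map (old H) A] = [seq val (lab v) | v <- A].
  by rewrite -map_comp.
have uA : uniq A by case/and3P: nH => /allP uH _ _; apply: uH.
rewrite sizeE (card_uniqP uA); case: replacementP => // [e Ae|A3].
  rewrite Ae /is_pair size_map edge2_size // eqxx mulnDr muln1 addnA.
  have idx : index (val e) (E H 2) = size (E H1 2).
    have := ssvalP e; rewrite mem_filter -[ssval e]Ae => /andP[A2 _].
    have := normalized_uniq nH; rewrite -Ae HE => uHA.
    exact: index_E uHA A2.
  rewrite Ae in old_labels.
  by rewrite /gadget !map_cons map_rcons old_labels /= idx.
by rewrite /is_pair size_map A3 /= old_labels.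
Qed.

Lemma encode_code (W : finType) (labW : W -> 'I_#|W|) (K : hypergraph W) :
  encode labW K =
  #|W| :: size K :: code [seq [seq val (labW v) | v <- A] | A <- K].
Proof.
rewrite /encode /code -map_comp; congr [:: _, _ & flatten _].
by apply: eq_map => A /=; rewrite size_map.
Qed.

Lemma triangle_program_constructs :
  exists2 t, t <= 133 * (L H).+1 & constructs_triangle triangle_program H lab t.
Proof.
have uA A : A \in H -> uniq A by case/and3P: nH => /allP uH _ _; apply: uH.
pose es := [seq [seq val (lab v) | v <- A] | A <- H].
have es23 : all pair_or_triple es.
  rewrite all_map; apply/allP => A AH.
  rewrite /= /pair_or_triple /is_pair size_map -(card_uniqP (uA A AH)).
  exact: (allP sH) _ AH.
have pairs : count is_pair es = size (E H 2).
  rewrite count_map size_filter; apply: eq_in_count => A AH.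
  by rewrite /= /is_pair size_map -(card_uniqP (uA A AH)).
have [t t_le run_t] := triangle_program_correct #|V| es23.
exists t.
  apply: leq_trans t_le _.
  by rewrite size_map leq_mul2l ltnS /L -addnA addnCA leq_addr.
have labels := @listed_triangle_labels [::] H erefl.
rewrite /= add0n in labels.
exists ground_lab, (listed_triangle H); split=> //.
- by move=> x y /(congr1 val) /= /ground_label_inj.
- have LT := listed_triangle_perm nH sH.
  rewrite /normal_incidence_list (normalized_perm LT) triangle_normalized //.
  exact: perm_map.
rewrite !encode_code.
have -> : [seq [seq val (ground_lab v) | v <- B] | B <- listed_triangle H]
  = label_triangle #|V| es by exact: labels.
rewrite card_ground // addnC -pairs -(size_map (map ground_label)) labels.
by rewrite -(size_map (map (fun v => val (lab v))) H).
Qed.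

End Labels.

Theorem theorem5p11 :
  (forall (V : finType) (H : hypergraph V),
     normalized H -> sizes_two_three H ->
     let m2 := size (E H 2) in
     let m3 := size (E H 3) in
     (normalized (triangle H) /\ three_uniform (triangle H)) /\
     (MinStop (triangle H) = lift_family H (MinStop H) :|: Dfamily H /\
      [disjoint lift_family H (MinStop H) & Dfamily H]) /\
     (#|ground H| = #|V| + 5 * m2 /\
      size (triangle H) = 4 * m2 + m3 /\
      L (triangle H) = #|V| + 21 * m2 + 4 * m3) /\
     (forall v : V, frequency (triangle H) (old H v) = frequency H v) /\
     (forall (e : edge2 H) (j : 'I_5),
        frequency (triangle H) (fresh e j) = 2) /\
     Delta (triangle H) <= maxn (Delta H) 2) /\
  (exists C : nat, forall (V : finType) (H : hypergraph V),
     normalized H -> sizes_two_three H -> L (triangle H) <= C * L H) /\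
  (exists (P : program) (C : nat), forall (V : finType) (H : hypergraph V)
     (lab : V -> 'I_#|V|),
     normalized H -> sizes_two_three H -> injective lab ->
     exists2 t : nat, t <= C * (L H).+1 & constructs_triangle P H lab t).
Proof.
split=> [V H nH sH m2 m3|].
  split.
    by split; [exact: triangle_normalized|exact: triangle_three_uniform].
  split; first by split; [exact: MinStop_triangle|exact: disjoint_lift].
  split; last split; last split.
  - by rewrite card_ground // size_triangle // L_triangle.
  - by move=> v; apply: frequency_old.
  - by move=> e j; apply: frequency_fresh.
  - exact: Delta_triangle.
split; first by exists 21 => V H; apply: L_triangle_le.
exists triangle_program, 133 => V H lab nH sH lab_inj.
exact: triangle_program_constructs.
Qed.
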